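(* For an integer $d\ge1$, let $A$ and $B$ each be a quantum system of dimension $d+1$ with orthonormal basis $\{|0\rangle,\dots,|d\rangle\}$, held by Alice and Bob, and let $n=\log(d+1)$. Let $|\Phi\rangle=\frac{1}{\sqrt d}(|11\rangle+\cdots+|dd\rangle)$, $P=|00\rangle\langle 00|+|\Phi\rangle\langle\Phi|$, and $U=|00\rangle\langle\Phi|+|\Phi\rangle\langle 00|+I-P$. Then for any $c>2$ and for all $n$ sufficiently large, $C^{\mathrm{G}}_{\mathrm{cap}}(U)\le 8c\log n$.
   Context: Logarithms are base 2. For a bipartite unitary $V$ on $A\otimes B$, $C^{\mathrm{G}}_{\mathrm{cap}}(V)$ denotes its asymptotic classical communication capacity assisted by arbitrary shared entanglement: the supremum of total rates (bits sent forward from Alice to Bob plus bits sent backward from Bob to Alice, per use of $V$) achievable with error tending to zero over asymptotically many uses of $V$, where Alice and Bob may use free local operations and any shared entangled state of their choice, and may communicate in both directions simultaneously through $V$. (For comparison, $U|00\rangle=|\Phi\rangle$, so $U$ can create $\log d$ ebits per use.) *)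

(* Defs.v *)
From HB Require Import structures.
From mathcomp Require Import all_boot all_order all_algebra.
From mathcomp Require Import reals exp.
From mathcomp Require Export complex.
Set Implicit Arguments. Unset Strict Implicit. Unset Printing Implicit Defensive.
Import Order.TTheory GRing.Theory Num.Theory.
Local Open Scope ring_scope.
Local Open Scope complex_scope.

(* Finite-dimensional linear operators on C^T, T a finite index type,  *)
(* represented by their matrix entries  M i j = <i|M|j>.               *)
Definition op (R : realType) (T : finType) := T -> T -> R[i].

Definition opmul (R : realType) (T : finType) (M N : op R T) : op R T :=
  fun i j => \sum_(k : T) M i k * N k j.
Definition opadj (R : realType) (T : finType) (M : op R T) : op R T :=
  fun i j => (M j i)^*.
Definition optr (R : realType) (T : finType) (M : op R T) : R[i] :=
  \sum_(i : T) M i i.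
Definition opid (R : realType) (T : finType) : op R T :=
  fun i j => (i == j)%:R.

(* positive semidefinite: <v|M|v> is real and >= 0 for every vector v *)
Definition psd (R : realType) (T : finType) (M : op R T) : Prop :=
  forall v : T -> R[i], 0 <= \sum_(i : T) \sum_(j : T) (v i)^* * M i j * v j.

Definition density (R : realType) (T : finType) (rho : op R T) : Prop :=
  psd rho /\ optr rho = 1.

(* a CPTP map given by a (finite) list of Kraus operators *)
Definition kraus_valid (R : realType) (T : finType) (ks : seq (op R T)) : Prop :=
  forall i j, \sum_(K <- ks) opmul (opadj K) K i j = (i == j)%:R.

Definition apply_ch (R : realType) (T : finType) (ks : seq (op R T)) (rho : op R T)
  : op R T :=
  fun i j => \sum_(K <- ks) opmul (opmul K rho) (opadj K) i j.

Definition povm (R : realType) (T : finType) (m : nat) (E : 'I_m -> op R T) : Prop :=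
  (forall k, psd (E k)) /\ (forall i j, \sum_(k < m) E k i j = (i == j)%:R).

(* Bipartite setting: A = B = C^(d+1).  Alice's lab is A (x) A',       *)
(* A' = C^a an arbitrary ancilla; Bob's lab is B (x) B', B' = C^b.     *)
Definition labT (d a : nat) : finType := ('I_d.+1 * 'I_a)%type.
Definition globT (d a b : nat) : finType := (labT d a * labT d b)%type.
Definition pairT (d : nat) : finType := ('I_d.+1 * 'I_d.+1)%type.

Definition liftA (R : realType) (d a b : nat) (K : op R (labT d a)) : op R (globT d a b) :=
  fun x y => K x.1 y.1 * (x.2 == y.2)%:R.
Definition liftB (R : realType) (d a b : nat) (K : op R (labT d b)) : op R (globT d a b) :=
  fun x y => K x.2 y.2 * (x.1 == y.1)%:R.
Definition liftV (R : realType) (d a b : nat) (V : op R (pairT d)) : op R (globT d a b) :=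
  fun x y => V (x.1.1, x.2.1) (y.1.1, y.2.1) * ((x.1.2 == y.1.2) && (x.2.2 == y.2.2))%:R.

(* A two-way classical communication protocol using V exactly k times. *)
(* Alice holds message x : 'I_nmsgF (sent forward), Bob y : 'I_nmsgB.  *)
(* They share an arbitrary initial state on their labs; in round       *)
(* t = 0..k each applies a local CPTP map depending on its own message *)
(* (rounds are separated by the k uses of V); finally Alice measures a *)
(* POVM to guess y and Bob measures a POVM to guess x.                 *)
Record protocol (R : realType) (d k : nat) := Protocol {
  labA : nat;
  labB : nat;
  nmsgF : nat;
  nmsgB : nat;
  init_state : op R (globT d labA labB);
  encA : 'I_nmsgF -> nat -> seq (op R (labT d labA));
  encB : 'I_nmsgB -> nat -> seq (op R (labT d labB));
  decA : 'I_nmsgB -> op R (labT d labA);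
  decB : 'I_nmsgF -> op R (labT d labB)
}.
Arguments init_state {R d k} p _ _.
Arguments encA {R d k} p _ _.
Arguments encB {R d k} p _ _.
Arguments decA {R d k} p _ _ _.
Arguments decB {R d k} p _ _ _.

Definition protocol_valid (R : realType) (d k : nat) (p : protocol R d k) : Prop :=
  (0 < nmsgF p)%N /\ (0 < nmsgB p)%N /\
  density (init_state p) /\
  (forall x t, kraus_valid (encA p x t)) /\
  (forall y t, kraus_valid (encB p y t)) /\
  povm (decA p) /\ povm (decB p).

Definition local_round (R : realType) (d k : nat) (p : protocol R d k)
  (x : 'I_(nmsgF p)) (y : 'I_(nmsgB p)) (t : nat)
  (rho : op R (globT d (labA p) (labB p))) : op R (globT d (labA p) (labB p)) :=
  apply_ch (map (@liftB R d (labA p) (labB p)) (encB p y t))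
    (apply_ch (map (@liftA R d (labA p) (labB p)) (encA p x t)) rho).

Definition use_V (R : realType) (d a b : nat) (V : op R (pairT d))
  (rho : op R (globT d a b)) : op R (globT d a b) :=
  opmul (opmul (@liftV R d a b V) rho) (opadj (@liftV R d a b V)).

Fixpoint evolve (R : realType) (d k : nat) (V : op R (pairT d)) (p : protocol R d k)
  (x : 'I_(nmsgF p)) (y : 'I_(nmsgB p)) (t : nat) : op R (globT d (labA p) (labB p)) :=
  match t with
  | 0 => local_round x y 0 (init_state p)
  | t'.+1 => local_round x y t (use_V V (evolve V x y t'))
  end.

Definition success_prob (R : realType) (d k : nat) (V : op R (pairT d)) (p : protocol R d k)
  (x : 'I_(nmsgF p)) (y : 'I_(nmsgB p)) : R :=
  complex.Re (optr (opmul (opmul (@liftA R d (labA p) (labB p) (decA p y)) (@liftB R d (labA p) (labB p) (decB p x)))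
                          (evolve V x y k))).

Definition avg_error (R : realType) (d k : nat) (V : op R (pairT d)) (p : protocol R d k) : R :=
  1 - ((nmsgF p * nmsgB p)%:R)^-1 *
      \sum_(x < nmsgF p) \sum_(y < nmsgB p) success_prob V x y.

(* (rf, rb) is an achievable (forward, backward) rate pair for V with  *)
(* arbitrary entanglement assistance and free local operations.        *)
Definition achievable (R : realType) (d : nat) (V : op R (pairT d)) (rf rb : R) : Prop :=
  0 <= rf /\ 0 <= rb /\
  forall eps : R, 0 < eps -> exists K : nat, forall k : nat, (K <= k)%N ->
    exists p : protocol R d k,
      [/\ protocol_valid p,
          (2 : R) `^ (k%:R * rf) <= (nmsgF p)%:R,
          (2 : R) `^ (k%:R * rb) <= (nmsgB p)%:R &
          avg_error V p <= eps].

Definition log2 (R : realType) (x : R) : R := ln x / ln 2.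

Definition ket00 (R : realType) (d : nat) (x : pairT d) : R[i] :=
  ((x.1 == ord0) && (x.2 == ord0))%:R.
Definition ketPhi (R : realType) (d : nat) (x : pairT d) : R[i] :=
  if (x.1 == x.2) && (x.1 != ord0) then ((Num.sqrt (d%:R : R))^-1)%:C else 0.

Definition Uop (R : realType) (d : nat) : op R (pairT d) :=
  fun x y => ket00 R x * (ketPhi R y)^* + ketPhi R x * (ket00 R y)^* + (x == y)%:R
             - ket00 R x * (ket00 R y)^* - ketPhi R x * (ketPhi R y)^*.

(* Main.v *)
Require Import Defs.
From HB Require Import structures.
From mathcomp Require Import all_boot all_order all_algebra.
From mathcomp Require Import reals exp complex spectral sesquilinear ring lra.
Set Implicit Arguments. Unset Strict Implicit. Unset Printing Implicit Defensive.
Import Order.TTheory GRing.Theory Num.Theory.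
Local Open Scope ring_scope.

(** Write [U = 1 - |v><v|] with [v = |00> - |Phi> = \sum_a c_a |aa>], so that
    [\sum_a c_a^2 = 2].  To bound forward communication, fix Bob's message and
    look for an operator [sigma] on Bob's lab, independent of Alice's message
    [x], that dominates all of Bob's reduced states: [Tr_A rho_x <= sigma].
    Alice's operations preserve this, and Bob's act on [sigma] without changing
    its trace.  For a use of [U], Cauchy-Schwarz over the terms of [v] shows that
    [Tr_A (U rho_x U^-1) <= 2 sigma + 4 tau (x) Tr_B sigma] where
    [tau = \sum_a c_a^2 |a><a|] has trace 2, so the trace of [sigma] grows at most
    tenfold.  After [k] uses, the success probabilities of a decoding
    measurement sum over [x] to at most [Tr sigma <= 10^k]; with error at most
    1/2 this leaves at most [2 * 10^k] forward messages.  Backward communication is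
    symmetric, so each rate is at most 5, a bound that does not depend on [d]. *)

(* [rmorphD], [rmorphB] and [rmorphM] leave [Num.conj] in a form that other lemmas
   no longer recognise. *)
Lemma conjCD (R : realType) (x y : R[i]) : (x + y)^* = x^* + y^*.
Proof. exact: rmorphD. Qed.

Lemma conjCB (R : realType) (x y : R[i]) : (x - y)^* = x^* - y^*.
Proof. exact: rmorphB. Qed.

Lemma conjCM (R : realType) (x y : R[i]) : (x * y)^* = x^* * y^*.
Proof. exact: rmorphM. Qed.

Lemma opadjE (R : realType) (T : finType) (M : op R T) (i j : T) :
  opadj M i j = (M j i)^*.
Proof. by []. Qed.

(** * Sesquilinear and quadratic forms of an operator *)

Definition sform (R : realType) (T : finType) (M : op R T) (u v : T -> R[i]) : R[i] :=
  \sum_(i : T) \sum_(j : T) (u i)^* * M i j * v j.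

Definition qform (R : realType) (T : finType) (M : op R T) (v : T -> R[i]) : R[i] :=
  sform M v v.

Lemma eq_sform (R : realType) (T : finType) (M : op R T) (u u' v v' : T -> R[i]) :
  u =1 u' -> v =1 v' -> sform M u v = sform M u' v'.
Proof.
move=> eu ev; apply: eq_bigr => i _; apply: eq_bigr => j _.
by rewrite eu ev.
Qed.

Lemma eq_qform (R : realType) (T : finType) (M : op R T) (v v' : T -> R[i]) :
  v =1 v' -> qform M v = qform M v'.
Proof. by move=> e; apply: eq_sform. Qed.

Lemma eq_qform_op (R : realType) (T : finType) (M N : op R T) (v : T -> R[i]) :
  (forall i j, M i j = N i j) -> qform M v = qform N v.
Proof.
move=> e; apply: eq_bigr => i _; apply: eq_bigr => j _.
by rewrite e.
Qed.

Lemma sform_sum (R : realType) (T I J : finType) (M : op R T)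
    (c : I -> R[i]) (u : I -> T -> R[i]) (e : J -> R[i]) (v : J -> T -> R[i]) :
  sform M (fun i => \sum_a c a * u a i) (fun i => \sum_b e b * v b i) =
  \sum_a \sum_b (c a)^* * e b * sform M (u a) (v b).
Proof.
rewrite /sform.
under eq_bigr => i _.
  under eq_bigr => j _.
    rewrite rmorph_sum /= -mulrA big_distrl /=.
    under eq_bigr => a _.
      rewrite !big_distrr /=.
      over.
    over.
  rewrite exchange_big /=.
  under eq_bigr => a _ do rewrite exchange_big /=.
  over.
rewrite exchange_big /=; apply: eq_bigr => a _.
rewrite exchange_big /=; apply: eq_bigr => b _.
rewrite big_distrr /=; apply: eq_bigr => i _.
rewrite big_distrr /=; apply: eq_bigr => j _.
by rewrite rmorphM; ring.
Qed.

Lemma sformDl (R : realType) (T : finType) (M : op R T) (u u' v : T -> R[i]) :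
  sform M (fun i => u i + u' i) v = sform M u v + sform M u' v.
Proof.
rewrite /sform -big_split /=; apply: eq_bigr => i _.
rewrite -big_split /=; apply: eq_bigr => j _.
by rewrite rmorphD !mulrDl.
Qed.

Lemma sformDr (R : realType) (T : finType) (M : op R T) (u v v' : T -> R[i]) :
  sform M u (fun i => v i + v' i) = sform M u v + sform M u v'.
Proof.
rewrite /sform -big_split /=; apply: eq_bigr => i _.
rewrite -big_split /=; apply: eq_bigr => j _.
by rewrite mulrDr.
Qed.

Lemma sformZl (R : realType) (T : finType) (M : op R T) (c : R[i]) (u v : T -> R[i]) :
  sform M (fun i => c * u i) v = c^* * sform M u v.
Proof.
rewrite /sform big_distrr /=; apply: eq_bigr => i _.
rewrite big_distrr /=; apply: eq_bigr => j _.
by rewrite rmorphM !mulrA.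
Qed.

Lemma sformZr (R : realType) (T : finType) (M : op R T) (c : R[i]) (u v : T -> R[i]) :
  sform M u (fun i => c * v i) = c * sform M u v.
Proof.
rewrite /sform big_distrr /=; apply: eq_bigr => i _.
rewrite big_distrr /=; apply: eq_bigr => j _.
by rewrite mulrCA mulrA.
Qed.

Lemma qformD (R : realType) (T : finType) (M : op R T) (u v : T -> R[i]) :
  qform M (fun i => u i + v i) = qform M u + qform M v + (sform M u v + sform M v u).
Proof. by rewrite /qform sformDl !sformDr; ring. Qed.

Lemma qformZ (R : realType) (T : finType) (M : op R T) (c : R[i]) (v : T -> R[i]) :
  qform M (fun i => c * v i) = c^* * c * qform M v.
Proof. by rewrite /qform sformZl sformZr mulrA. Qed.

Lemma psd_qform_ge0 (R : realType) (T : finType) (M : op R T) (v : T -> R[i]) :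
  psd M -> 0 <= qform M v.
Proof. exact. Qed.

(** By the parallelogram law, the two sides differ by the form at [u + v], which is nonnegative. *)
Lemma psd_qformB_le (R : realType) (T : finType) (M : op R T) (u v : T -> R[i]) :
  psd M -> qform M (fun i => u i + (-1) * v i) <= 2 * qform M u + 2 * qform M v.
Proof.
move=> hM; have := psd_qform_ge0 (fun i => u i + v i) hM.
rewrite !qformD qformZ sformZl sformZr rmorphN1 => h.
rewrite -subr_ge0; move: h; congr (0 <= _); ring.
Qed.

(* Lagrange's identity: the difference of the two sides is half the sum of
   the values of the form at the vectors [c a * z b - c b * z a]. *)
Lemma psd_qform_cauchy (R : realType) (T I : finType) (M : op R T)
    (c : I -> R[i]) (z : I -> T -> R[i]) :
  psd M -> (forall a, (c a)^* = c a) ->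
  qform M (fun i => \sum_a c a * z a i) <= (\sum_a c a ^+ 2) * \sum_a qform M (z a).
Proof.
move=> hM hc.
have h : 0 <= \sum_a \sum_b qform M (fun i => c a * z b i + (- c b) * z a i).
  by apply: sumr_ge0 => a _; apply: sumr_ge0 => b _; exact: psd_qform_ge0.
have e : \sum_a \sum_b qform M (fun i => c a * z b i + (- c b) * z a i) =
   2 * ((\sum_a c a ^+ 2) * \sum_a qform M (z a)
        - qform M (fun i => \sum_a c a * z a i)).
  rewrite {3}/qform sform_sum.
  under eq_bigr => a _.
    under eq_bigr => b _.
      rewrite qformD !qformZ !sformZl !sformZr rmorphN /= !hc.
      have -> : c a * c a * qform M (z b) + - c b * - c b * qform M (z a) +
         (c a * (- c b * sform M (z b) (z a)) + - c b * (c a * sform M (z a) (z b)))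
         = c a ^+ 2 * qform M (z b) + c b ^+ 2 * qform M (z a)
          + ((- (c b * c a * sform M (z b) (z a))) + (- (c a * c b * sform M (z a) (z b)))) by ring.
      over.
    rewrite !big_split /=; over.
  rewrite !big_split /=.
  under eq_bigr => a _ do rewrite -big_distrr /=.
  rewrite -big_distrl /=.
  have -> : \sum_i \sum_b c b ^+ 2 * qform M (z i) =
     (\sum_a c a ^+ 2) * \sum_a qform M (z a).
    by rewrite big_distrr /=; apply: eq_bigr => a _; rewrite big_distrl.
  have -> : \sum_i \sum_i0 - (c i0 * c i * sform M (z i0) (z i)) =
     - \sum_a \sum_b (c a)^* * c b * sform M (z a) (z b).
    rewrite exchange_big /= -sumrN; apply: eq_bigr => a _.
    by rewrite -sumrN; apply: eq_bigr => b _; rewrite hc.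
  have -> : \sum_i \sum_i0 - (c i * c i0 * sform M (z i) (z i0)) =
     - \sum_a \sum_b (c a)^* * c b * sform M (z a) (z b).
    rewrite -sumrN; apply: eq_bigr => a _.
    by rewrite -sumrN; apply: eq_bigr => b _; rewrite hc.
  ring.
by move: h; rewrite e pmulr_rge0 ?ltr0n // subr_ge0.
Qed.

Lemma sform_delta (R : realType) (T : finType) (M : op R T) (i j : T) :
  sform M (fun k => (k == i)%:R) (fun k => (k == j)%:R) = M i j.
Proof.
rewrite /sform (bigD1 i) //= [X in _ + X]big1 => [|k /negPf nk]; last first.
  by apply: big1 => l _; rewrite nk rmorph0 !mul0r.
rewrite (bigD1 j) //= [X in _ + X + _]big1 => [|k /negPf nk]; last by rewrite nk mulr0.
by rewrite !eqxx rmorph1 !addr0 mulr1 mul1r.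
Qed.

(** Polarization: positivity makes the form real at [e i + c * e j]. Taking [c = 1] and [c = 'i]
    gives the sum and the difference of the conjugates of [M i j] and [M j i], hence each of
    them. *)
Lemma psd_herm (R : realType) (T : finType) (M : op R T) (i j : T) :
  psd M -> (M i j)^* = M j i.
Proof.
move=> hM.
pose e (k : T) (l : T) : R[i] := (l == k)%:R.
have hd k : (M k k)^* = M k k.
  apply: conj_Creal; apply: ger0_real.
  by rewrite -(sform_delta M k k); exact: (psd_qform_ge0 (e k) hM).
have h (c : R[i]) : (c * M i j)^* + (c^* * M j i)^* = c * M i j + c^* * M j i.
  have := conj_Creal (ger0_real (psd_qform_ge0 (fun l => e i l + c * e j l) hM)).
  rewrite qformD qformZ sformZl sformZr /qform !sform_delta.
  rewrite conjCD [(_ + _ * _)^*]conjCD [(_ * M j j)^*]conjCM [(c^* * c)^*]conjCM conjCK !hd [c * c^*]mulrC.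
  by rewrite conjCD => /addrI.
have := h 1; have := h 'i.
rewrite !conjCM !rmorph1 conjCK conjCi !mul1r => h2 h1.
have {}h2 : 'i * ((M j i)^* - (M i j)^*) = 'i * (M i j - M j i).
  by move: h2; rewrite mulrBr mulrBr !mulNr addrC.
move/(mulfI (neq0Ci _)): h2 => h2.
have : 2 * (M i j)^* = 2 * M j i.
  have -> : 2 * (M i j)^* = ((M i j)^* + (M j i)^*) - ((M j i)^* - (M i j)^*) by ring.
  by rewrite h1 h2; ring.
by apply: mulfI; rewrite pnatr_eq0.
Qed.

(** * Gram decompositions of positive operators *)

(** By the spectral theorem, the vectors [g k] can be eigenvectors scaled by the square roots of
    their eigenvalues. *)
Lemma psd_gram_mx (R : realType) (n : nat) (A : 'M[R[i]]_n) :
  (forall v : 'I_n -> R[i], 0 <= qform (fun i j => A i j) v) ->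
  exists g : 'I_n -> 'I_n -> R[i], forall i j, A i j = \sum_k g k i * (g k j)^*.
Proof.
move=> hA.
have herm : A \is hermsymmx.
  apply/is_hermitianmxP; rewrite expr0 scale1r; apply/matrixP => i j.
  by rewrite !mxE; exact/esym/(psd_herm j i hA).
have := orthomx_spectralP (hermitian_normalmx herm).
set P := spectralmx A; set D := spectral_diag A => eA.
have uP : P \is unitarymx by exact: spectral_unitarymx.
rewrite (invmx_unitary uP) in eA.
have eD : P *m A *m (P ^t*)%sesqui = diag_mx D.
  rewrite eA !mulmxA (unitarymxP uP) mul1mx -mulmxA.
  by rewrite (unitarymxP uP) mulmx1.
(* Each eigenvalue is the value of the form at its eigenvector, the conjugated row [k] of [P]. *)
have D_ge0 k : 0 <= D 0 k.
  have := hA (fun i => (P k i)^*).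
  suff -> : qform (fun i j => A i j) (fun i => (P k i)^*) = D 0 k by [].
  have := congr1 (fun X : 'M_n => X k k) eD; rewrite !mxE eqxx mulr1n => <-.
  rewrite /qform /sform exchange_big /=; apply: eq_bigr => j _.
  rewrite !mxE big_distrl /=; apply: eq_bigr => i _.
  by rewrite conjCK.
exists (fun k i => (P k i)^* * sqrtC (D 0 k)) => i j.
rewrite eA mul_mx_diag !mxE; apply: eq_bigr => k _.
rewrite !mxE conjCM conjCK.
have -> : (sqrtC (D 0 k))^* = sqrtC (D 0 k).
  by apply: conj_Creal; rewrite ger0_real ?sqrtC_ge0.
by rewrite mulrACA -expr2 sqrtCK mulrAC.
Qed.

Lemma psd_gram (R : realType) (T : finType) (M : op R T) : psd M ->
  exists (n : nat) (g : 'I_n -> T -> R[i]), forall i j, M i j = \sum_k g k i * (g k j)^*.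
Proof.
move=> hM; pose A := \matrix_(i, j) M (enum_val i) (enum_val j) : 'M[R[i]]_#|T|.
have hA (v : 'I_#|T| -> R[i]) : 0 <= qform (fun i j => A i j) v.
  have := psd_qform_ge0 (fun i => v (enum_rank i)) hM.
  congr (0 <= _); rewrite /qform /sform (reindex (@enum_val T T)) /=; last first.
    by apply: onW_bij; exact: enum_val_bij.
  apply: eq_bigr => i _; rewrite (reindex (@enum_val T T)) /=; last first.
    by apply: onW_bij; exact: enum_val_bij.
  by apply: eq_bigr => j _; rewrite !enum_valK mxE.
have [g hg] := psd_gram_mx hA.
exists #|T|, (fun k i => g k (enum_rank i)) => i j.
by rewrite -hg mxE !enum_rankK.
Qed.

Lemma sum_delta (R : realType) (T : finType) (F : T -> R[i]) (i : T) :
  \sum_j (i == j)%:R * F j = F i.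
Proof.
rewrite (bigD1 i) //= eqxx mul1r big1 ?addr0 // => j.
by rewrite eq_sym => /negPf ->; rewrite mul0r.
Qed.

(** Through this formula, positivity of [N] and inequalities between forms pass to traces against a
    positive operator. *)
Lemma optr_opmul_gram (R : realType) (T I : finType) (M N : op R T) (g : I -> T -> R[i]) :
  (forall i j, M i j = \sum_k g k i * (g k j)^*) ->
  optr (opmul M N) = \sum_k qform N (g k).
Proof.
move=> hM; rewrite /optr /opmul.
under eq_bigr => i _.
  under eq_bigr => j _ do rewrite hM big_distrl /=.
  rewrite exchange_big /=; over.
rewrite exchange_big /=; apply: eq_bigr => k _.
rewrite exchange_big /=; apply: eq_bigr => j _; apply: eq_bigr => i _.
by rewrite -[LHS]mulrA [LHS]mulrC.
Qed.

(** * Conjugation and Kraus channels *)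

Lemma opconjE (R : realType) (T : finType) (K M : op R T) (i j : T) :
  opmul (opmul K M) (opadj K) i j =
  sform M (fun p => (K i p)^*) (fun q => (K j q)^*).
Proof.
rewrite /sform exchange_big /=; apply: eq_bigr => q _.
rewrite /opmul opadjE big_distrl /=; apply: eq_bigr => p _.
by rewrite conjCK.
Qed.

Lemma qform_conj (R : realType) (T : finType) (K M : op R T) (v : T -> R[i]) :
  qform (opmul (opmul K M) (opadj K)) v = qform M (fun i => \sum_k (K k i)^* * v k).
Proof.
have e : (fun i => \sum_k (K k i)^* * v k) =1 (fun i => \sum_k v k * (K k i)^*).
  by move=> i; apply: eq_bigr => k _; rewrite mulrC.
rewrite (eq_qform M e) {2}/qform sform_sum.
apply: eq_bigr => i _; apply: eq_bigr => j _.
by rewrite opconjE mulrAC.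
Qed.

Lemma psd_conj (R : realType) (T : finType) (K M : op R T) :
  psd M -> psd (opmul (opmul K M) (opadj K)).
Proof.
by move=> hM v; rewrite -/(sform _ v v) -/(qform _ v) qform_conj; exact: psd_qform_ge0.
Qed.

Lemma qform_apply_ch (R : realType) (T : finType) (ks : seq (op R T)) (M : op R T)
    (v : T -> R[i]) :
  qform (apply_ch ks M) v = \sum_(K <- ks) qform M (fun i => \sum_k (K k i)^* * v k).
Proof.
transitivity (\sum_(K <- ks) qform (opmul (opmul K M) (opadj K)) v).
  rewrite /qform /sform [RHS]exchange_big /=; apply: eq_bigr => i _.
  rewrite [RHS]exchange_big /=; apply: eq_bigr => j _.
  by rewrite -big_distrl -big_distrr.
by apply: eq_bigr => K _; rewrite qform_conj.
Qed.

Lemma psd_apply_ch (R : realType) (T : finType) (ks : seq (op R T)) (M : op R T) :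
  psd M -> psd (apply_ch ks M).
Proof.
move=> hM v; rewrite -/(sform _ v v) -/(qform _ v) qform_apply_ch.
by apply: sumr_ge0 => K _; exact: psd_qform_ge0.
Qed.

Lemma optr_apply_ch (R : realType) (T : finType) (ks : seq (op R T)) (M : op R T) :
  kraus_valid ks -> optr (apply_ch ks M) = optr M.
Proof.
move=> hks.
transitivity (\sum_p \sum_q (\sum_(K <- ks) opmul (opadj K) K q p) * M p q); last first.
  apply: eq_bigr => p _; rewrite -[RHS](sum_delta (M p)).
  by apply: eq_bigr => q _; rewrite hks eq_sym.
rewrite /optr /apply_ch exchange_big /=.
under [RHS]eq_bigr => p _ do (under eq_bigr => q _ do rewrite big_distrl /=).
under [RHS]eq_bigr => p _ do rewrite exchange_big /=.
rewrite [RHS]exchange_big /=; apply: eq_bigr => K _.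
under eq_bigr => i _ do rewrite opconjE.
rewrite /sform exchange_big /=; apply: eq_bigr => p _.
rewrite exchange_big /=; apply: eq_bigr => q _.
rewrite /opmul big_distrl /=; apply: eq_bigr => i _.
by rewrite opadjE conjCK; ring.
Qed.

(** * Reduced operators and domination *)

(* A global system [G] is split as [O] (the lab traced out) times [L] (the lab
   kept); [s] and its inverse [t] let the two labs play either role. *)
Definition ptr (R : realType) (O L G : finType) (s : O * L -> G) (rho : op R G) : op R L :=
  fun l l' => \sum_o rho (s (o, l)) (s (o, l')).

(** The Loewner order between the reduced operator and [sigma]. Since [sigma] need not have trace 1,
    one [sigma] can serve a whole family of states. *)
Definition dominated (R : realType) (O L G : finType) (s : O * L -> G)
    (rho : op R G) (sigma : op R L) : Prop :=
  forall w, qform (ptr s rho) w <= qform sigma w.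

(** The product vector [|o> (x) w], carried to [G] by [t]. *)
Definition tens (R : realType) (O L G : finType) (t : G -> O * L) (o : O) (w : L -> R[i]) :
    G -> R[i] :=
  fun g => (o == (t g).1)%:R * w (t g).2.

Lemma big_glue (R : realType) (O L G : finType) (s : O * L -> G) (F : G -> R[i]) :
  bijective s -> \sum_g F g = \sum_o \sum_l F (s (o, l)).
Proof.
move=> bs; rewrite (reindex s) /=; last exact: onW_bij.
by rewrite pair_bigA; apply: eq_bigr => -[].
Qed.

Lemma sum_tens (R : realType) (O L G : finType) (s : O * L -> G) (t : G -> O * L)
    (F : G -> R[i]) (o : O) (w : L -> R[i]) :
  cancel s t -> cancel t s ->
  \sum_g F g * tens t o w g = \sum_l F (s (o, l)) * w l.
Proof.
move=> st ts; rewrite (big_glue _ (Bijective st ts)) exchange_big /=.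
apply: eq_bigr => l _.
rewrite -[RHS](sum_delta (fun o1 => F (s (o1, l)) * w l)).
by apply: eq_bigr => o1 _; rewrite /tens st /= mulrCA.
Qed.

Lemma qform_tens (R : realType) (O L G : finType) (s : O * L -> G) (t : G -> O * L)
    (rho : op R G) (o : O) (w : L -> R[i]) :
  cancel s t -> cancel t s ->
  qform rho (tens t o w) =
  \sum_l \sum_l' (w l)^* * rho (s (o, l)) (s (o, l')) * w l'.
Proof.
move=> st ts; rewrite /qform /sform.
under eq_bigr => g _ do rewrite (sum_tens _ _ _ st ts).
rewrite exchange_big [RHS]exchange_big /=; apply: eq_bigr => l' _.
transitivity (\sum_g rho g (s (o, l')) * w l' * tens t o (fun l => (w l)^*) g).
  by apply: eq_bigr => g _; rewrite /tens conjCM rmorph_nat [RHS]mulrC mulrA.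
rewrite (sum_tens _ _ _ st ts); apply: eq_bigr => l _.
by rewrite [LHS]mulrC mulrA.
Qed.

Lemma qform_ptr (R : realType) (O L G : finType) (s : O * L -> G) (t : G -> O * L)
    (rho : op R G) (w : L -> R[i]) :
  cancel s t -> cancel t s -> qform (ptr s rho) w = \sum_o qform rho (tens t o w).
Proof.
move=> st ts; under [RHS]eq_bigr => o _ do rewrite (qform_tens _ _ _ st ts).
rewrite [RHS]exchange_big /=; apply: eq_bigr => l _.
rewrite [RHS]exchange_big /=; apply: eq_bigr => l' _.
by rewrite /ptr big_distrr /= big_distrl.
Qed.

(** No signalling: under the partial trace each [K] can be moved cyclically next to its adjoint, and
    the Kraus condition sums these products to the identity. *)
Lemma ptr_apply_other (R : realType) (O L G : finType) (s : O * L -> G)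
    (lift : op R O -> op R G) (ks : seq (op R O)) (rho : op R G) (l l' : L) :
  bijective s ->
  (forall K o l o' l', lift K (s (o, l)) (s (o', l')) = K o o' * (l == l')%:R) ->
  kraus_valid ks -> ptr s (apply_ch (map lift ks) rho) l l' = ptr s rho l l'.
Proof.
move=> bs hl hks.
transitivity (\sum_p \sum_q (\sum_(K <- ks) opmul (opadj K) K q p) *
    rho (s (p, l)) (s (q, l'))); last first.
  apply: eq_bigr => p _.
  rewrite -[RHS](sum_delta (fun q => rho (s (p, l)) (s (q, l')))).
  by apply: eq_bigr => q _; rewrite hks eq_sym.
rewrite /ptr /apply_ch.
under eq_bigr => o _ do rewrite big_map.
rewrite exchange_big /=.
under [RHS]eq_bigr => p _ do (under eq_bigr => q _ do rewrite big_distrl /=).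
under [RHS]eq_bigr => p _ do rewrite exchange_big /=.
rewrite [RHS]exchange_big /=; apply: eq_bigr => K _.
under eq_bigr => o _.
  rewrite opconjE /sform (big_glue _ bs).
  under eq_bigr => p _.
    rewrite exchange_big (big_glue _ bs) /=.
    under eq_bigr => q _.
      rewrite exchange_big /=.
      under eq_bigr => l1 _.
        under eq_bigr => l2 _.
          rewrite !hl !conjCM !conjCK !rmorph_nat.
          (* With the Kronecker deltas in front, [sum_delta] collapses the sums over [l2] and
             [l1]. *)
          have -> : K o p * (l == l1)%:R * rho (s (p, l1)) (s (q, l2)) *
            ((K o q)^* * (l' == l2)%:R) = (l' == l2)%:R * ((l == l1)%:R *
            (K o p * rho (s (p, l1)) (s (q, l2)) * (K o q)^*)) by ring.
          over.
        rewrite sum_delta; over.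
      rewrite sum_delta; over.
    over.
  over.
rewrite exchange_big /=; apply: eq_bigr => p _.
rewrite exchange_big /=; apply: eq_bigr => q _.
rewrite /opmul big_distrl /=; apply: eq_bigr => o _.
by rewrite opadjE; ring.
Qed.

Lemma ptr_apply_kept (R : realType) (O L G : finType) (s : O * L -> G)
    (lift : op R L -> op R G) (ks : seq (op R L)) (rho : op R G) (l l' : L) :
  bijective s ->
  (forall K o l o' l', lift K (s (o, l)) (s (o', l')) = K l l' * (o == o')%:R) ->
  ptr s (apply_ch (map lift ks) rho) l l' = apply_ch ks (ptr s rho) l l'.
Proof.
move=> bs hl; rewrite /ptr /apply_ch.
under eq_bigr => o _ do rewrite big_map.
rewrite exchange_big /=; apply: eq_bigr => K _.
rewrite opconjE /sform.
under eq_bigr => o _.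
  rewrite opconjE /sform (big_glue _ bs) exchange_big /=.
  under eq_bigr => p _.
    rewrite exchange_big (big_glue _ bs) exchange_big /=.
    under eq_bigr => q _.
      rewrite exchange_big /=.
      under eq_bigr => o1 _.
        under eq_bigr => o2 _.
          rewrite !hl !conjCM !conjCK !rmorph_nat.
          have -> : K l p * (o == o1)%:R * rho (s (o1, p)) (s (o2, q)) *
            ((K l' q)^* * (o == o2)%:R) = (o == o2)%:R * ((o == o1)%:R *
            (K l p * rho (s (o1, p)) (s (o2, q)) * (K l' q)^*)) by ring.
          over.
        rewrite sum_delta; over.
      rewrite sum_delta; over.
    over.
  over.
rewrite exchange_big /=; apply: eq_bigr => p _.
rewrite exchange_big /=; apply: eq_bigr => q _.
by rewrite conjCK big_distrr /= big_distrl.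
Qed.

Lemma dominated_apply_other (R : realType) (O L G : finType) (s : O * L -> G)
    (lift : op R O -> op R G) (ks : seq (op R O)) (rho : op R G) (sigma : op R L) :
  bijective s ->
  (forall K o l o' l', lift K (s (o, l)) (s (o', l')) = K o o' * (l == l')%:R) ->
  kraus_valid ks -> dominated s rho sigma ->
  dominated s (apply_ch (map lift ks) rho) sigma.
Proof.
move=> bs hl hks hr w.
by rewrite (eq_qform_op w (fun l l' => ptr_apply_other rho l l' bs hl hks)).
Qed.

Lemma dominated_apply_kept (R : realType) (O L G : finType) (s : O * L -> G)
    (lift : op R L -> op R G) (ks : seq (op R L)) (rho : op R G) (sigma : op R L) :
  bijective s ->
  (forall K o l o' l', lift K (s (o, l)) (s (o', l')) = K l l' * (o == o')%:R) ->
  dominated s rho sigma ->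
  dominated s (apply_ch (map lift ks) rho) (apply_ch ks sigma).
Proof.
move=> bs hl hr w.
rewrite (eq_qform_op w (fun l l' => ptr_apply_kept ks rho l l' bs hl)).
by rewrite !qform_apply_ch; apply: ler_sum => K _.
Qed.

(** * Traces against local measurements *)

Lemma optr_ptr (R : realType) (O L G : finType) (s : O * L -> G) (rho : op R G) :
  bijective s -> optr (ptr s rho) = optr rho.
Proof. by move=> bs; rewrite /optr (big_glue _ bs) exchange_big. Qed.

(** Products of Gram vectors of [E] and [F] are Gram vectors of [X], so the trace is a sum of values
    of the form of [rho]. *)
Lemma tensor_trace_ge0 (R : realType) (O L G : finType) (s : O * L -> G) (t : G -> O * L)
    (E : op R O) (F : op R L) (X rho : op R G) :
  cancel t s -> psd E -> psd F -> psd rho ->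
  (forall o l o' l', X (s (o, l)) (s (o', l')) = E o o' * F l l') ->
  0 <= optr (opmul X rho).
Proof.
move=> ts /psd_gram[n [e he]] /psd_gram[m [f hf]] hr hX.
pose h (k : 'I_n * 'I_m) (g : G) := e k.1 (t g).1 * f k.2 (t g).2.
rewrite (@optr_opmul_gram _ _ _ _ _ h) => [|g g'].
  by apply: sumr_ge0 => k _; exact: psd_qform_ge0.
rewrite -{1}[g]ts -{1}[g']ts.
case eg: (t g) => [o l]; case eg': (t g') => [o' l'].
rewrite hX he hf big_distrlr /= pair_bigA /=; apply: eq_bigr => -[k k'] _ /=.
by rewrite /h eg eg' /= conjCM mulrACA.
Qed.

Lemma optr_opmul_le (R : realType) (T : finType) (F M N : op R T) :
  psd F -> (forall w, qform M w <= qform N w) ->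
  optr (opmul F M) <= optr (opmul F N).
Proof.
move=> /psd_gram[n [f hf]] hMN.
by rewrite !(optr_opmul_gram _ hf); apply: ler_sum => k _.
Qed.

Lemma optr_sum_povm (R : realType) (T : finType) (m : nat) (F : 'I_m -> op R T)
    (M : op R T) :
  povm F -> \sum_x optr (opmul (F x) M) = optr M.
Proof.
move=> [_ hF]; rewrite /optr /opmul exchange_big /=; apply: eq_bigr => i _.
rewrite exchange_big /= -[RHS](sum_delta (fun j => M j i)); apply: eq_bigr => j _.
by rewrite -big_distrl /= hF.
Qed.

(* The other lab's outcome is dropped by summing over its whole measurement. *)
Lemma tensor_trace_le_ptr (R : realType) (O L G : finType) (s : O * L -> G)
    (t : G -> O * L) (m : nat) (E : 'I_m -> op R O) (F : op R L)
    (X : 'I_m -> op R G) (rho : op R G) (y : 'I_m) :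
  cancel s t -> cancel t s -> povm E -> psd F -> psd rho ->
  (forall y o l o' l', X y (s (o, l)) (s (o', l')) = E y o o' * F l l') ->
  optr (opmul (X y) rho) <= optr (opmul F (ptr s rho)).
Proof.
move=> st ts [pE sE] pF pr hX; have bs := Bijective st ts.
have -> : optr (opmul F (ptr s rho)) = \sum_y optr (opmul (X y) rho).
  transitivity (\sum_o \sum_l \sum_l' F l l' * rho (s (o, l')) (s (o, l))).
    rewrite /optr /opmul [RHS]exchange_big /=; apply: eq_bigr => l _.
    rewrite [RHS]exchange_big /=; apply: eq_bigr => l' _.
    by rewrite /ptr big_distrr.
  rewrite /optr [RHS]exchange_big /= (big_glue _ bs); apply: eq_bigr => o _.
  apply: eq_bigr => l _; rewrite /opmul.
  under [RHS]eq_bigr => z _ do rewrite (big_glue _ bs) exchange_big /=.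
  rewrite [RHS]exchange_big /=; apply: eq_bigr => l' _.
  rewrite [RHS]exchange_big /=.
  rewrite -[LHS](sum_delta (fun o' => F l l' * rho (s (o', l')) (s (o, l)))).
  apply: eq_bigr => o' _; under [RHS]eq_bigr => z _ do rewrite hX -mulrA.
  by rewrite -big_distrl /= sE.
rewrite (bigD1 y) //= lerDl; apply: sumr_ge0 => z _.
by apply: (tensor_trace_ge0 ts (pE z) pF pr) => *; exact: hX.
Qed.

(** Each state may be replaced by [sigma]. As [sigma] does not depend on [x], the operators [F x]
    then sum to the identity against it. *)
Lemma sum_success_le (R : realType) (O L G : finType) (s : O * L -> G)
    (t : G -> O * L) (m n : nat) (E : 'I_m -> op R O) (F : 'I_n -> op R L)
    (X : 'I_m -> 'I_n -> op R G) (rho : 'I_n -> op R G) (sigma : op R L) (y : 'I_m) :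
  cancel s t -> cancel t s -> povm E -> povm F -> (forall x, psd (rho x)) ->
  (forall x, dominated s (rho x) sigma) ->
  (forall y x o l o' l', X y x (s (o, l)) (s (o', l')) = E y o o' * F x l l') ->
  \sum_x optr (opmul (X y x) (rho x)) <= optr sigma.
Proof.
move=> st ts hE hF hr hd hX; rewrite -(optr_sum_povm sigma hF).
apply: ler_sum => x _.
apply: le_trans (optr_opmul_le (hF.1 x) (hd x)).
by apply: (tensor_trace_le_ptr (X := X^~ x) y st ts hE (hF.1 x) (hr x)) => *; exact: hX.
Qed.

(** * One use of the interaction *)

(** This is [2 sigma + 2 C (tau (x) Tr_D sigma)], where [C = \sum_a c a ^+ 2] and
    [tau = \sum_a c a ^+ 2 |a><a|]. *)
Definition reflstep (R : realType) (D B : finType) (c : D -> R[i]) (sigma : op R (D * B)%type)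
    : op R (D * B)%type :=
  fun l l' => 2 * sigma l l' + 2 * (\sum_a c a ^+ 2) * ((l.1 == l'.1)%:R * c l.1 ^+ 2 *
     \sum_a sigma (a, l.2) (a, l'.2)).

(** The diagonal factor [tau] has trace [C], which supplies the second power of [C]. *)
Lemma optr_reflstep (R : realType) (D B : finType) (c : D -> R[i]) (sigma : op R (D * B)%type) :
  optr (reflstep c sigma) = (2 + 2 * (\sum_a c a ^+ 2) ^+ 2) * optr sigma.
Proof.
transitivity (2 * optr sigma + 2 * (\sum_a c a ^+ 2) *
    \sum_l c l.1 ^+ 2 * \sum_a sigma (a, l.2) (a, l.2)).
  rewrite /reflstep; move: (\sum_a c a ^+ 2) => C.
  rewrite /optr !big_distrr -big_split /=; apply: eq_bigr => l _.
  by rewrite eqxx mul1r.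
have -> : \sum_l c l.1 ^+ 2 * (\sum_a sigma (a, l.2) (a, l.2)) =
    (\sum_a c a ^+ 2) * optr sigma; last by ring.
rewrite -(pair_bigA _ (fun a b => c a ^+ 2 * \sum_a' sigma (a', b) (a', b))) /=.
under eq_bigr => a _ do rewrite -big_distrr /=.
rewrite -big_distrl /=; congr (_ * _); rewrite exchange_big /= pair_bigA /=.
by apply: eq_bigr => -[].
Qed.

(** The operator [|a><b| (x) 1] applied to [w]. *)
Definition slice (R : realType) (D B : finType) (b a : D) (w : D * B -> R[i]) : D * B -> R[i] :=
  fun l => (a == l.1)%:R * w (b, l.2).

Lemma qform_reflstep (R : realType) (D B : finType) (c : D -> R[i])
    (sigma : op R (D * B)%type) (w : D * B -> R[i]) :
  qform (reflstep c sigma) w = 2 * qform sigma w +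
    2 * (\sum_a c a ^+ 2) * \sum_b c b ^+ 2 * \sum_a qform sigma (slice b a w).
Proof.
transitivity (2 * qform sigma w + 2 * (\sum_a c a ^+ 2) *
   qform (fun l l' => (l.1 == l'.1)%:R * c l.1 ^+ 2 * \sum_a sigma (a, l.2) (a, l'.2)) w).
  rewrite /reflstep; move: (\sum_a c a ^+ 2) => C.
  rewrite /qform /sform [in RHS]big_distrr [X in _ = _ + X]big_distrr -big_split /=.
  apply: eq_bigr => l _.
  rewrite [in RHS]big_distrr [X in _ = _ + X]big_distrr -big_split /=.
  by apply: eq_bigr => l' _; ring.
congr (_ + _ * _).
transitivity (\sum_b \sum_l2 \sum_l2' (w (b, l2))^* * (c b ^+ 2 *
   \sum_a sigma (a, l2) (a, l2')) * w (b, l2')).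
  rewrite pair_bigA /=; apply: eq_bigr => -[b l2] _ /=.
  transitivity (\sum_b' \sum_l2' (w (b, l2))^* * ((b == b')%:R * c b ^+ 2 *
     \sum_a sigma (a, l2) (a, l2')) * w (b', l2')).
    by rewrite pair_bigA /=; apply: eq_bigr => -[].
  rewrite exchange_big /=; apply: eq_bigr => l2' _.
  rewrite -[RHS](sum_delta (fun b' => (w (b, l2))^* * (c b ^+ 2 *
     \sum_a sigma (a, l2) (a, l2')) * w (b', l2'))).
  by apply: eq_bigr => b' _; ring.
apply: eq_bigr => b _.
transitivity (c b ^+ 2 * \sum_a \sum_l2 \sum_l2' (w (b, l2))^* *
   sigma (a, l2) (a, l2') * w (b, l2')).
  rewrite [in RHS]exchange_big [RHS]big_distrr /=; apply: eq_bigr => l2 _.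
  rewrite [in RHS]exchange_big [RHS]big_distrr /=; apply: eq_bigr => l2' _.
  by rewrite -big_distrl -big_distrr /=; ring.
congr (_ * _); apply: eq_bigr => a _.
have e : slice b a w =1 tens id a (fun l2 => w (b, l2)) by [].
rewrite (eq_qform sigma e).
by rewrite (@qform_tens _ _ _ _ id).
Qed.

(* [X] is [1 - |v><v|] for [v = \sum_a c a |aa>]; its adjoint sends the vector
   [tens o w] to itself minus a combination of [#|D|] slices of [w]. *)
Lemma dominated_reflection (R : realType) (D A B G : finType)
    (s : (D * A) * (D * B) -> G) (t : G -> (D * A) * (D * B)) (c : D -> R[i])
    (X rho : op R G) (sigma : op R (D * B)%type) :
  cancel s t -> cancel t s -> (forall a, (c a)^* = c a) ->
  (forall o l o' l', X (s (o, l)) (s (o', l')) =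
     ((o == o') && (l == l'))%:R -
     (o.1 == l.1)%:R * c o.1 * ((o'.1 == l'.1)%:R * c o'.1) *
     ((o.2 == o'.2) && (l.2 == l'.2))%:R) ->
  psd rho -> dominated s rho sigma ->
  dominated s (opmul (opmul X rho) (opadj X)) (reflstep c sigma).
Proof.
move=> st ts hc hX hr hd w.
pose C := \sum_a c a ^+ 2.
have c2 a : 0 <= c a ^+ 2 by rewrite expr2 -{2}hc mul_conjC_ge0.
have C0 : 0 <= C by exact: sumr_ge0.
rewrite (qform_ptr _ _ st ts).
(* The factor [c o.1] stays inside the vectors, so that Cauchy-Schwarz with weights [c a] costs
   exactly [C] and leaves [c o.1 ^+ 2] in the sum. *)
have key (o : D * A) : qform (opmul (opmul X rho) (opadj X)) (tens t o w) <=
   2 * qform rho (tens t o w) +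
   2 * (C * \sum_a c o.1 ^+ 2 * qform rho (tens t (a, o.2) (slice o.1 a w))).
  rewrite qform_conj.
  have e : (fun g => \sum_k (X k g)^* * tens t o w k) =1
    (fun g => tens t o w g + (-1) *
       \sum_a c a * (c o.1 * tens t (a, o.2) (slice o.1 a w) g)).
    move=> g; rewrite (sum_tens (fun k => (X k g)^*) _ _ st ts) -[g]ts.
    case: (t g) => -[a i] [b j]; rewrite /tens st /=.
    case: o => p q /=.
    transitivity (((p, q) == (a, i))%:R * w (b, j) -
        c p * c a * (a == b)%:R * (q == i)%:R * w (p, j)).
      rewrite -[in RHS](sum_delta w (b, j)).
      rewrite -[w (p, j)](sum_delta w (p, j)).
      rewrite 2!big_distrr -sumrB /=; apply: eq_bigr => l _.
      rewrite hX conjCB !conjCM !rmorph_nat !hc /= (eq_sym (b, j)).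
      have -> : ((p, j) == l) = (p == l.1) && (l.2 == j).
        by rewrite -pair_eqE /= (eq_sym j).
      rewrite -!mulnb !natrM; ring.
    congr (_ + _); rewrite mulN1r; congr (- _).
    rewrite -[LHS](sum_delta (fun a0 => c p * c a0 * (a0 == b)%:R * (q == i)%:R * w (p, j))).
    apply: eq_bigr => a0 _.
    rewrite /slice -pair_eqE /= (eq_sym a a0) -mulnb natrM; ring.
  rewrite (eq_qform _ e); apply: le_trans (psd_qformB_le _ _ hr) _.
  rewrite lerD2l ler_pM2l ?ltr0n //.
  apply: le_trans (psd_qform_cauchy _ hr hc) _.
  rewrite ler_wpM2l //; apply: ler_sum => a _.
  by rewrite qformZ hc expr2.
apply: le_trans (ler_sum _ (fun o _ => key o)) _.
rewrite big_split /= -!big_distrr /= -(qform_ptr _ _ st ts) qform_reflstep.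
apply: lerD; first by rewrite ler_wpM2l ?ler0n.
rewrite -mulrA ler_wpM2l ?ler0n // ler_wpM2l //.
rewrite -(pair_bigA _ (fun o1 o2 => \sum_a c o1 ^+ 2 *
    qform rho (tens t (a, o2) (slice o1 a w)))) /=.
apply: ler_sum => b _; rewrite exchange_big /= big_distrr /=.
apply: ler_sum => a _; rewrite -big_distrr /= ler_wpM2l //.
(* For fixed [b] and [a], the vectors [(a, o2)] are only some of the basis vectors of the traced
   lab. Adding the nonnegative terms with [o1 != a] completes the partial trace, to which domination
   applies. *)
apply: le_trans (hd _); rewrite (qform_ptr _ _ st ts).
rewrite -(pair_bigA _ (fun o1 o2 => qform rho (tens t (o1, o2) (slice b a w)))) /=.
rewrite (bigD1 a) //= lerDl; apply: sumr_ge0 => o1 _; apply: sumr_ge0 => o2 _.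
exact: psd_qform_ge0.
Qed.

(* [U = 1 - |v><v|] with [v = |00> - |Phi> = \sum_a ucoef a |aa>]. *)
Definition ucoef (R : realType) (d : nat) (a : 'I_d.+1) : R[i] :=
  if a == ord0 then 1 else - ((Num.sqrt (d%:R : R))^-1)%:C%C.

Lemma conj_ucoef (R : realType) (d : nat) (a : 'I_d.+1) :
  (ucoef R a)^* = ucoef R a.
Proof.
apply: conj_Creal; rewrite /ucoef; case: ifP => _; first exact: rpred1.
by rewrite rpredN complex_real.
Qed.

(** The index 0 contributes 1, and the [d] others contribute [1 / d] each. *)
Lemma sum_ucoef_sqr (R : realType) (d : nat) : (0 < d)%N ->
  \sum_(a < d.+1) ucoef R a ^+ 2 = 2.
Proof.
move=> d0; rewrite big_ord_recl /= {1}/ucoef eqxx expr1n.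
rewrite (eq_bigr (fun=> (d%:R)^-1)) => [|a _].
  by rewrite sumr_const card_ord -[_ *+ d]mulr_natl mulfV // pnatr_eq0 -lt0n.
rewrite /ucoef /= sqrrN -rmorphXn exprVn sqr_sqrtr ?ler0n //.
by rewrite fmorphV rmorph_nat.
Qed.

(** Both vectors are real, and [- |v><v|] expands into the two exchange terms of [U] together with
    [- P]. *)
Lemma UopE (R : realType) (d : nat) (x y : pairT d) :
  Uop R x y = (x == y)%:R -
    (x.1 == x.2)%:R * ucoef R x.1 * ((y.1 == y.2)%:R * ucoef R y.1).
Proof.
have hv (z : pairT d) : ket00 R z - ketPhi R z = (z.1 == z.2)%:R * ucoef R z.1.
  rewrite /ket00 /ketPhi /ucoef; case: z => a b /=.
  case: (altP (a =P ord0)) => [->|na].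
    by rewrite (eq_sym b); case: eqP => _ /=; rewrite ?mul1r ?mul0r subr0.
  by case: (a == b); rewrite ?mul1r ?mul0r sub0r ?oppr0.
have hc (z : pairT d) : (ket00 R z)^* = ket00 R z /\ (ketPhi R z)^* = ketPhi R z.
  split; first exact: rmorph_nat.
  rewrite /ketPhi; case: ifP => _; last exact: rmorph0.
  by apply: conj_Creal; rewrite complex_real.
rewrite -!hv /Uop (hc y).1 (hc y).2; ring.
Qed.

Lemma dominated_useU_B (R : realType) (d a b : nat) (rho : op R (globT d a b))
    (sigma : op R (labT d b)) :
  psd rho -> dominated (@id (labT d a * labT d b)) rho sigma ->
  dominated (@id (labT d a * labT d b)) (use_V (@Uop R d) rho) (reflstep (@ucoef R d) sigma).
Proof.
apply: (@dominated_reflection R _ _ _ (globT d a b) id id (@ucoef R d)) => //.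
  exact: conj_ucoef.
move=> [o1 o2] [l1 l2] [o1' o2'] [l1' l2']; rewrite /liftV UopE /= mulrBl; congr (_ - _).
by rewrite -!pair_eqE /= -!mulnb !natrM; ring.
Qed.

Lemma dominated_useU_A (R : realType) (d a b : nat) (rho : op R (globT d a b))
    (sigma : op R (labT d a)) :
  psd rho -> dominated (fun p : labT d b * labT d a => (p.2, p.1)) rho sigma ->
  dominated (fun p : labT d b * labT d a => (p.2, p.1)) (use_V (@Uop R d) rho)
    (reflstep (@ucoef R d) sigma).
Proof.
apply: (@dominated_reflection R _ _ _ (globT d a b) _ (fun g => (g.2, g.1)) (@ucoef R d)) => //.
- by case.
- by case.
- exact: conj_ucoef.
move=> [o1 o2] [l1 l2] [o1' o2'] [l1' l2']; rewrite /liftV UopE /= mulrBl; congr (_ - _).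
  by rewrite -!pair_eqE /= -!mulnb !natrM; ring.
(* [UopE] takes the coefficient at Alice's index, while the reflection wants it at Bob's; the delta
   in front forces the two indices to agree. *)
rewrite (eq_sym l1) (eq_sym l1') -!mulnb !natrM.
by case: (altP (o1 =P l1)) => [->|_]; case: (altP (o1' =P l1')) => [->|_];
  rewrite ?mul0r ?mulr0 ?mul0r //; ring.
Qed.

(** * Evolution of a whole protocol *)

(** Only the channels of the kept lab enter, so the bound is the same for all messages of the other
    lab. *)
Fixpoint kept_bound (R : realType) (D B : finType) (c : D -> R[i])
    (ks : nat -> seq (op R (D * B)%type)) (sigma : op R (D * B)%type) (t : nat)
    : op R (D * B)%type :=
  match t with
  | 0 => apply_ch (ks 0) sigma
  | t'.+1 => apply_ch (ks t) (reflstep c (kept_bound c ks sigma t'))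
  end.

Lemma optr_kept_bound (R : realType) (D B : finType) (c : D -> R[i])
    (ks : nat -> seq (op R (D * B)%type)) (sigma : op R (D * B)%type) (t : nat) :
  (forall t, kraus_valid (ks t)) ->
  optr (kept_bound c ks sigma t) = (2 + 2 * (\sum_a c a ^+ 2) ^+ 2) ^+ t * optr sigma.
Proof.
move=> hks; elim: t => [|t IH] /=; first by rewrite optr_apply_ch // mul1r.
by rewrite optr_apply_ch // optr_reflstep IH (exprS _ t) [LHS]mulrA.
Qed.

Lemma psd_local_round (R : realType) (d k : nat) (p : protocol R d k)
    (x : 'I_(nmsgF p)) (y : 'I_(nmsgB p)) (t : nat) (rho : op R (globT d (labA p) (labB p))) :
  psd rho -> psd (local_round x y t rho).
Proof. by move=> hr; do 2 apply: psd_apply_ch. Qed.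

Lemma psd_evolve (R : realType) (d k : nat) (V : op R (pairT d)) (p : protocol R d k)
    (x : 'I_(nmsgF p)) (y : 'I_(nmsgB p)) (t : nat) :
  protocol_valid p -> psd (evolve V x y t).
Proof.
move=> [_ [_ [[hi _] _]]].
by elim: t => [|t IH] /=; apply: psd_local_round => //; exact: psd_conj.
Qed.

Lemma dominated_evolve_B (R : realType) (d k : nat) (p : protocol R d k)
    (x : 'I_(nmsgF p)) (y : 'I_(nmsgB p)) (t : nat) :
  protocol_valid p ->
  dominated (@id (labT d (labA p) * labT d (labB p))) (evolve (@Uop R d) x y t)
    (kept_bound (@ucoef R d) (encB p y)
       (ptr (@id (labT d (labA p) * labT d (labB p))) (init_state p)) t).
Proof.
move=> hp; have [_ [_ [_ [hA [hB _]]]]] := hp.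
have bid : bijective (@id (labT d (labA p) * labT d (labB p))) by exists id.
have round rho sigma t' :
    dominated (@id (labT d (labA p) * labT d (labB p))) rho sigma ->
    dominated (@id (labT d (labA p) * labT d (labB p))) (local_round x y t' rho)
      (apply_ch (encB p y t') sigma).
  by move=> h; apply: dominated_apply_kept => //; apply: dominated_apply_other.
elim: t => [|t IH] /=; apply: round; first by move=> w.
by apply: dominated_useU_B => //; exact: psd_evolve.
Qed.

Lemma dominated_evolve_A (R : realType) (d k : nat) (p : protocol R d k)
    (x : 'I_(nmsgF p)) (y : 'I_(nmsgB p)) (t : nat) :
  protocol_valid p ->
  dominated (fun q : labT d (labB p) * labT d (labA p) => (q.2, q.1))
    (evolve (@Uop R d) x y t)
    (kept_bound (@ucoef R d) (encA p x)
       (ptr (fun q : labT d (labB p) * labT d (labA p) => (q.2, q.1)) (init_state p)) t).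
Proof.
move=> hp; have [_ [_ [_ [hA [hB _]]]]] := hp.
set s := fun q : labT d (labB p) * labT d (labA p) => (q.2, q.1).
have bs : bijective s by exists (fun g => (g.2, g.1)); case.
have round rho sigma t' : dominated s rho sigma ->
    dominated s (local_round x y t' rho) (apply_ch (encA p x t') sigma).
  by move=> h; apply: dominated_apply_other => //; apply: dominated_apply_kept.
elim: t => [|t IH] /=; apply: round; first by move=> w.
by apply: dominated_useU_A => //; exact: psd_evolve.
Qed.

Lemma opmul_liftA_liftB (R : realType) (d a b : nat) (E : op R (labT d a))
    (F : op R (labT d b)) (g g' : globT d a b) :
  opmul (@liftA R d a b E) (@liftB R d a b F) g g' = E g.1 g'.1 * F g.2 g'.2.
Proof.
rewrite /opmul.
transitivity (\sum_o \sum_l (liftA E g (o, l) : R[i]) * liftB F (o, l) g').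
  by rewrite pair_bigA; apply: eq_bigr => -[].
rewrite -[RHS](sum_delta (fun o => E g.1 o * F g.2 g'.2) g'.1).
apply: eq_bigr => o _; rewrite -[RHS](sum_delta (fun l => (g'.1 == o)%:R * (E g.1 o * F l g'.2)) g.2).
by apply: eq_bigr => l _; rewrite /liftA /liftB /= (eq_sym o); ring.
Qed.

(** * From success probabilities to rates *)

Lemma sum_Re_le (R : realType) (I : finType) (z : I -> R[i]) (n : nat) :
  \sum_i z i <= n%:R -> \sum_i complex.Re (z i) <= n%:R.
Proof.
have -> : n%:R = (n%:R : R)%:C%C :> R[i] by rewrite rmorph_nat.
rewrite lecE => /andP[_] /=.
by rewrite (big_morph (@complex.Re R) (id1 := 0) (op1 := +%R)) // => -[? ?] [? ?].
Qed.

Lemma sum_success_forward (R : realType) (d k : nat) (p : protocol R d k) (y : 'I_(nmsgB p)) :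
  (0 < d)%N -> protocol_valid p ->
  \sum_x success_prob (@Uop R d) x y <= (10 ^ k)%:R.
Proof.
move=> d0 hp; have [_ [_ [[_ tr1] [hA [hB [dA dB]]]]]] := hp.
apply: sum_Re_le.
pose S := kept_bound (@ucoef R d) (encB p y)
       (ptr (@id (labT d (labA p) * labT d (labB p))) (init_state p)) k.
(* The initial trace is 1, and each use multiplies it by [2 + 2 * 2 ^+ 2 = 10]. *)
have -> : (10 ^ k)%:R = optr S :> R[i].
  rewrite optr_kept_bound // optr_ptr; last by exists id.
  rewrite tr1 mulr1 (sum_ucoef_sqr R d0) natrX; congr (_ ^+ _); ring.
apply: (@sum_success_le _ _ _ _ id id _ _ (decA p) (decB p)
  (fun y x => opmul (@liftA R d (labA p) (labB p) (decA p y))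
                    (@liftB R d (labA p) (labB p) (decB p x)))
  (fun x => evolve (@Uop R d) x y k)) => //.
- by move=> x; exact: psd_evolve.
- by move=> x; exact: dominated_evolve_B.
- by move=> y' x o l o' l'; rewrite opmul_liftA_liftB.
Qed.

Lemma sum_success_backward (R : realType) (d k : nat) (p : protocol R d k) (x : 'I_(nmsgF p)) :
  (0 < d)%N -> protocol_valid p ->
  \sum_y success_prob (@Uop R d) x y <= (10 ^ k)%:R.
Proof.
move=> d0 hp; have [_ [_ [[_ tr1] [hA [hB [dA dB]]]]]] := hp.
apply: sum_Re_le.
set s := fun q : labT d (labB p) * labT d (labA p) => (q.2, q.1).
pose t := fun q : labT d (labA p) * labT d (labB p) => (q.2, q.1).
have st : cancel s t by case.
have ts : cancel t s by case.
pose S := kept_bound (@ucoef R d) (encA p x) (ptr s (init_state p)) k.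
have -> : (10 ^ k)%:R = optr S :> R[i].
  rewrite optr_kept_bound // optr_ptr; last by exists t.
  rewrite tr1 mulr1 (sum_ucoef_sqr R d0) natrX; congr (_ ^+ _); ring.
apply: (@sum_success_le _ _ _ _ s t _ _ (decB p) (decA p)
  (fun x y => opmul (@liftA R d (labA p) (labB p) (decA p y))
                    (@liftB R d (labA p) (labB p) (decB p x)))
  (fun y => evolve (@Uop R d) x y k)) => //.
- by move=> y; exact: psd_evolve.
- by move=> y; exact: dominated_evolve_A.
- by move=> x' y o l o' l'; rewrite opmul_liftA_liftB mulrC.
Qed.

(** The error bound makes the number of message pairs at most twice the total [S] of the success
    probabilities. Bounding [S] through the sums over one party's messages and cancelling the other
    party's count limits the former. *)
Lemma avg_error_nmsg_le (R : realType) (d k : nat) (p : protocol R d k) :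
  (0 < d)%N -> protocol_valid p -> avg_error (@Uop R d) p <= 2^-1 ->
  (nmsgF p)%:R <= 2 * (10 ^ k)%:R :> R /\ (nmsgB p)%:R <= 2 * (10 ^ k)%:R :> R.
Proof.
move=> d0 hp; have [F0 [B0 _]] := hp; rewrite /avg_error natrM.
set S := \sum_(x < _) _ => hS.
have F0' : 0 < (nmsgF p)%:R :> R by rewrite ltr0n.
have B0' : 0 < (nmsgB p)%:R :> R by rewrite ltr0n.
have {}hS : (nmsgF p)%:R * (nmsgB p)%:R <= 2 * S.
  have : 2^-1 <= ((nmsgF p)%:R * (nmsgB p)%:R)^-1 * S by lra.
  by rewrite [_^-1 * S]mulrC ler_pdivlMr ?mulr_gt0 // ler_pdivrMl.
have S1 : S <= (nmsgF p)%:R * (10 ^ k)%:R.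
  rewrite mulr_natl -{1}(card_ord (nmsgF p)) -sumr_const.
  by apply: ler_sum => x _; exact: sum_success_backward.
have S2 : S <= (nmsgB p)%:R * (10 ^ k)%:R.
  rewrite mulr_natl -{1}(card_ord (nmsgB p)) -sumr_const /S exchange_big.
  by apply: ler_sum => y _; exact: sum_success_forward.
split; first rewrite -(ler_pM2r B0'); last rewrite -(ler_pM2l F0').
  by apply: le_trans hS _; rewrite -mulrA ler_pM2l ?ltr0n // mulrC.
by apply: le_trans hS _; rewrite mulrCA ler_pM2l ?ltr0n.
Qed.

(** The constant comes from [2 * 10 <= 32 = 2 ^ 5]: with at least one use, a single factor 32
    absorbs the leading 2, and [10 <= 32] handles the other uses. *)
Lemma rate_le5 (R : realType) (k m : nat) (r : R) :
  2 `^ (k.+1%:R * r) <= m%:R -> m%:R <= 2 * (10 ^ k.+1)%:R :> R -> r <= 5.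
Proof.
move=> h1 h2; have ln2 : 0 < ln 2 :> R by rewrite ln_gt0 // ltr1n.
have h : 2 `^ (k.+1%:R * r) <= 2 `^ (k.+1%:R * 5) :> R.
  apply: le_trans h1 (le_trans h2 _).
  rewrite -natrM (_ : k.+1%:R * 5 = (k.+1 * 5)%:R); last by rewrite natrM.
  rewrite powR_mulrn // -natrX ler_nat (mulnC _ 5) expnM.
  have -> : (2 ^ 5 = 32)%N by [].
  rewrite !expnS mulnA leq_mul //.
  by elim: (k) => // n IH; rewrite !expnS leq_mul.
have : ln (2 `^ (k.+1%:R * r)) <= ln (2 `^ (k.+1%:R * 5) : R).
  by rewrite ler_ln ?posrE ?powR_gt0.
by rewrite !ln_powR ler_pM2r // ler_pM2l ?ltr0n.
Qed.

(* For c > 2 and all n = log2(d+1) large enough, every achievable total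
   rate rf + rb of U (i.e. C^G_cap(U), the supremum of these) is at most 8 c log2 n. *)
Theorem theorem2 (R : realType) (c : R) (hc : 2 < c) :
  exists N : R, forall d : nat, (1 <= d)%N -> N <= log2 (d.+1%:R : R) ->
    forall rf rb : R, @achievable R d (@Uop R d) rf rb ->
      rf + rb <= 8 * c * log2 (log2 (d.+1%:R : R)).
Proof.
(* From [log2 (d + 1) >= 2] the iterated logarithm is at least 1. Error 1/2 suffices, and [K.+1]
   uses are taken so that their number is positive. *)
exists 2 => d d1 hn rf rb [_ [_ /(_ 2^-1)]].
rewrite invr_gt0 ltr0n => /(_ isT)[K /(_ K.+1 (leqnSn K))[p [hp hF hB he]]].
have [bF bB] := avg_error_nmsg_le d1 hp he.
have rf5 := rate_le5 hF bF; have rb5 := rate_le5 hB bB.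
have log1 : 1 <= log2 (log2 d.+1%:R) :> R.
  have ln2 : 0 < ln 2 :> R by rewrite ln_gt0 // ltr1n.
  rewrite {1}/log2 ler_pdivlMr // mul1r ler_ln ?posrE ?ltr0n //.
  by apply: lt_le_trans hn.
(* The total rate is at most 10, while [8 * c] exceeds 16. *)
nra.
Qed.
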